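(* Let $\mu$ be a partition and $n\in\mathbf{N}$. Let $T$ be a plethystic semistandard tableau of shape $\mu^{(1^n)}$. If the weight of $T$ is maximal in the dominance order among the weights of plethystic semistandard tableaux of shape $\mu^{(1^n)}$, then the set of $\mu$-tableau entries of $T$ is closed.
   Context: A tableau with entries in a totally ordered set is semistandard if its rows are weakly increasing from left to right and its columns strictly increasing from top to bottom. Let $\mathrm{SSYT}_{\mathbf{N}}(\mu)$ be the set of semistandard $\mu$-tableaux with entries from $\mathbf{N}=\{1,2,\ldots\}$, totally ordered by: $t<u$ if and only if, in the rightmost column in which $t$ and $u$ differ, the greatest entry not appearing in both columns lies in $u$. A plethystic semistandard tableau of shape $\mu^\nu$ is a semistandard $\nu$-tableau with entries in $\mathrm{SSYT}_{\mathbf{N}}(\mu)$; thus for $\nu=(1^n)$ it is a strictly increasing column of $n$ semistandard $\mu$-tableaux. Its weight is the composition $(\beta_1,\ldots,\beta_M)$ where $M$ is the greatest integer appearing in its $\mu$-tableau entries and $\beta_b$ is the total number of occurrences of $b$ in its $\mu$-tableau entries. Dominance order on compositions: $\beta\unrhd\gamma$ if $\beta_1+\cdots+\beta_i\ge\gamma_1+\cdots+\gamma_i$ for all $i$, parts beyond the last being $0$. A set $\mathcal{T}$ of semistandard $\mu$-tableaux is closed if whenever $t\in\mathcal{T}$ and $s$ is a semistandard $\mu$-tableau obtained from $t$ by changing a single entry $c$ to $c-1$, then $s\in\mathcal{T}$. *)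

(* Defs.v *)
From HB Require Import structures.
From mathcomp Require Import all_boot all_order.

Set Implicit Arguments.
Unset Strict Implicit.
Unset Printing Implicit Defensive.

Import Order.TTheory.

Definition is_partition (mu : seq nat) : bool :=
  sorted geq mu && (0 \notin mu).

(* A tableau is the sequence of its rows, in the English convention.  Rows
   and columns are indexed from 0. *)

Definition column (T : Type) (t : seq (seq T)) (j : nat) : seq T :=
  pmap (fun r => onth r j) t.

(* This is the first part of mu when mu is a partition. *)
Definition ncolumns (mu : seq nat) : nat := \max_(r <- mu) r.

Definition semistandard d (T : orderType d) (mu : seq nat)
    (t : seq (seq T)) : bool :=
  [&& shape t == mu,
      all (sorted <=%O) t
    & [forall j : 'I_(ncolumns mu), sorted <%O (column t j)]].

(* Semistandard mu-tableaux with entries in {1, 2, ...}. *)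
Record ssyt (mu : seq nat) := Ssyt {
  rows :> seq (seq nat);
  _ : semistandard mu rows && (0 \notin flatten rows)
}.

HB.instance Definition _ mu := [isSub for @rows mu].
HB.instance Definition _ mu := [Choice of ssyt mu by <:].

Definition greatest_diff (a b : seq nat) : nat :=
  \max_(x <- [seq x <- a ++ b | (x \in a) != (x \in b)]) x.

Definition ssyt_lt mu (t u : ssyt mu) : bool :=
  [exists j : 'I_(ncolumns mu),
    [&& column t j != column u j,
        [forall k : 'I_(ncolumns mu), (j < k) ==> (column t k == column u k)]
      & greatest_diff (column t j) (column u j) \in column u j]].

Lemma bigmax_mem (s : seq nat) : s != [::] -> \max_(x <- s) x \in s.
Proof.
elim: s => // x [|y s] IH _; first by rewrite big_seq1 mem_head.
rewrite big_cons inE /maxn; case: ifP => _; last by rewrite eqxx.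
by rewrite IH ?orbT.
Qed.

Lemma greatest_diff_gt a b y :
  greatest_diff a b < y -> (y \in a) = (y \in b).
Proof.
move=> lty; apply/eqP/negPn/negP => ney.
have yin : y \in [seq x <- a ++ b | (x \in a) != (x \in b)].
  by rewrite mem_filter ney mem_cat; case: (y \in a) (y \in b) ney => -[].
by move: lty; rewrite ltnNge /greatest_diff (@leq_bigmax_seq _ _ xpredT id y yin isT).
Qed.

Lemma greatest_diff_in (a b : seq nat) :
  sorted <%O a -> sorted <%O b -> a != b ->
  (greatest_diff a b \in a) != (greatest_diff a b \in b).
Proof.
move=> sa sb neab.
suff /bigmax_mem : [seq x <- a ++ b | (x \in a) != (x \in b)] != [::].
  by rewrite mem_filter => /andP[].
apply: contra neab => /eqP s0; apply/eqP.
apply: (irr_sorted_eq lt_trans ltxx sa sb) => x; apply/eqP/negPn/negP => nex.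
have : x \in [seq x <- a ++ b | (x \in a) != (x \in b)].
  by rewrite mem_filter nex mem_cat; case: (x \in a) (x \in b) nex => -[].
by rewrite s0.
Qed.

Lemma greatest_diffC a b : greatest_diff a b = greatest_diff b a.
Proof.
rewrite /greatest_diff !big_filter (perm_big (b ++ a)) /=.
  by apply: eq_bigl => x; rewrite eq_sym.
by rewrite perm_catC.
Qed.

Lemma greatest_diffP (a b : seq nat) : sorted <%O a -> sorted <%O b ->
  reflect (exists x, [/\ x \in b, x \notin a
                       & forall y, x < y -> (y \in a) = (y \in b)])
          ((a != b) && (greatest_diff a b \in b)).
Proof.
move=> sa sb; apply: (iffP andP) => [[neab xb]|[x [xb xa xmax]]].
  exists (greatest_diff a b); split=> //; last exact: greatest_diff_gt.
  by have := greatest_diff_in sa sb neab; rewrite xb; case: (_ \in a).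
have neab : a != b by apply: contraNneq xa => ->.
have ne := greatest_diff_in sa sb neab; split=> //.
case: (ltngtP x (greatest_diff a b)) => [/xmax e|/greatest_diff_gt|<- //].
- by rewrite e eqxx in ne.
- by rewrite xb (negbTE xa).
Qed.

Lemma column_sorted mu (t : ssyt mu) (j : 'I_(ncolumns mu)) :
  sorted <%O (column t j).
Proof. by case: t => t /= /andP[/and3P[_ _ /forallP]]. Qed.

Lemma column_inj (T : Type) (t u : seq (seq T)) :
  shape t = shape u -> (forall j, column t j = column u j) -> t = u.
Proof.
elim: t u => [|r t IH] [|r' u] //= [sr st] e.
have er : r = r'.
  apply: eq_from_onth => j; have := e j; rewrite /column /=.
  have : onth r j = onth r' j :> bool by rewrite !onthTE sr.
  by case: (onth r j) (onth r' j) => [x|] [y|] //= _ [->].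
congr (_ :: _) => //; apply: IH => // j; have := e j; rewrite /column /= er.
by case: (onth r' j) => //= x [].
Qed.

Lemma ssyt_inj mu (t u : ssyt mu) :
  (forall j : 'I_(ncolumns mu), column t j = column u j) -> t = u.
Proof.
have short (v : ssyt mu) j : ncolumns mu <= j -> column v j = [::].
  case: v => v /= /andP[/and3P[/eqP sv _ _] _] lej.
  have : all (fun r => size r <= j) v.
    apply/allP => r rv; apply: leq_trans lej.
    have : size r \in mu by rewrite -sv; apply: map_f.
    by move=> rmu; apply: (@leq_bigmax_seq _ _ xpredT id _ rmu isT).
  elim: v {sv} => //= r v IH /andP[szr /IH]; rewrite /column /= => ->.
  by rewrite onth_default.
move=> e; apply: val_inj; apply: column_inj => [|j].
  by case: t u {e} => [t /= /andP[/and3P[/eqP-> _ _] _]]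
                  [u /= /andP[/and3P[/eqP-> _ _] _]].
case: (ltnP j (ncolumns mu)) => [ltj|lej]; first exact: (e (Ordinal ltj)).
by rewrite !short.
Qed.

Lemma ssyt_ltP mu (t u : ssyt mu) :
  reflect (exists j : 'I_(ncolumns mu),
             [/\ (column t j != column u j) &&
                   (greatest_diff (column t j) (column u j) \in column u j)
               & forall k : 'I_(ncolumns mu), j < k ->
                   column t k = column u k])
          (ssyt_lt t u).
Proof.
apply: (iffP existsP) => -[j].
  case/and3P=> ne /forallP later inu; exists j; rewrite ne inu; split=> // k ltjk.
  exact/eqP/(implyP (later k)).
case=> /andP[ne inu] later; exists j; rewrite ne inu andbT /=.
by apply/forallP => k; apply/implyP => /later ->.
Qed.

Lemma ssyt_lt_irr mu : irreflexive (@ssyt_lt mu).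
Proof. by move=> t; apply/ssyt_ltP => -[j []]; rewrite eqxx. Qed.

Lemma ssyt_lt_trans mu : transitive (@ssyt_lt mu).
Proof.
move=> u t v /ssyt_ltP[j [tuj later]] /ssyt_ltP[k [uvk later']]; apply/ssyt_ltP.
case: (ltngtP j k) => [ltjk|ltkj|/val_inj ejk].
- exists k; rewrite later //; split=> // i ltki.
  by rewrite later ?later' // (ltn_trans ltjk).
- exists j; rewrite -later' //; split=> // i ltji.
  by rewrite later ?later' // (ltn_trans ltkj).
subst k; exists j; split=> [|i ltji]; last by rewrite later ?later'.
have [st su sv] := And3 (column_sorted t j) (column_sorted u j) (column_sorted v j).
move: tuj uvk => /(greatest_diffP st su)[x [xu xt xmax]].
move=> /(greatest_diffP su sv)[y [yv yu ymax]]; apply/(greatest_diffP st sv).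
case: (ltngtP x y) => [ltxy|ltyx|exy]; last by rewrite -exy xu in yu.
- exists y; split=> // [|z ltyz]; first by rewrite xmax.
  by rewrite xmax ?ymax // (ltn_trans ltxy).
- exists x; split=> // [|z ltxz]; first by rewrite -ymax.
  by rewrite xmax ?ymax // (ltn_trans ltyx).
Qed.

Fact ssyt_display : Order.disp_t. Proof. by []. Qed.

HB.instance Definition _ mu :=
  Order.Lt_isPOrder.Build ssyt_display (ssyt mu)
    (@ssyt_lt_irr mu) (@ssyt_lt_trans mu).

Lemma ssyt_ltE mu (t u : ssyt mu) : (t < u)%O = ssyt_lt t u.
Proof. by []. Qed.

Lemma ssyt_le_total mu : total (<=%O : rel (ssyt mu)).
Proof.
move=> t u; case: (eqVneq t u) => [-> | ne]; first by rewrite lexx.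
suff : (t < u)%O || (u < t)%O by case/orP=> /ltW ->; rewrite ?orbT.
have [j0 nej0] : exists j : 'I_(ncolumns mu), column t j != column u j.
  apply/existsP; apply: contraR ne => /existsPn eqc; apply/eqP/ssyt_inj => j.
  by apply/eqP/negPn/eqc.
case: (@arg_maxnP _ j0 (fun j => column t j != column u j) val nej0) => j nej jmax.
have later (k : 'I_(ncolumns mu)) : j < k -> column t k = column u k.
  by move=> ltjk; apply/eqP; apply: contraTT ltjk => /jmax; rewrite -leqNgt.
have := greatest_diff_in (column_sorted t j) (column_sorted u j) nej.
case inu : (greatest_diff _ _ \in column u j) => inn; apply/orP.
  by left; apply/ssyt_ltP; exists j; rewrite nej inu.
right; apply/ssyt_ltP; exists j; rewrite eq_sym nej greatest_diffC.
by split=> [|k /later //]; move: inn; case: (_ \in _).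
Qed.

HB.instance Definition _ mu :=
  Order.POrder_isTotal.Build ssyt_display (ssyt mu) (@ssyt_le_total mu).

(* Plethystic semistandard tableaux of shape mu^nu. *)
Definition plethystic (mu nu : seq nat) (T : seq (seq (ssyt mu))) : bool :=
  semistandard nu T.

Definition entries mu (T : seq (seq (ssyt mu))) : seq nat :=
  flatten [seq flatten (rows t) | t <- flatten T].

(* The item of index b is the multiplicity of b.+1. *)
Definition weight mu (T : seq (seq (ssyt mu))) : seq nat :=
  [seq count_mem b (entries T) | b <- iota 1 (\max_(x <- entries T) x)].

Definition dominates (beta gamma : seq nat) : Prop :=
  forall i, sumn (take i gamma) <= sumn (take i beta).

Definition weight_maximal (mu nu : seq nat) (T : seq (seq (ssyt mu))) : Prop :=
  forall T' : seq (seq (ssyt mu)), plethystic nu T' ->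
    dominates (weight T') (weight T) -> weight T' = weight T.

(* The entry in row i and column j; it is 0 outside the shape. *)
Definition entry mu (t : ssyt mu) (i j : nat) : nat := nth 0 (nth [::] t i) j.

(* s is obtained from t by changing one entry c to c - 1.  The equation
   forces (i, j) to be in the shape. *)
Definition decrement mu (t s : ssyt mu) : Prop :=
  exists i j, entry t i j = (entry s i j).+1 /\
    forall i' j', (i', j') != (i, j) -> entry s i' j' = entry t i' j'.

Definition closed_ssyt mu (A : {pred ssyt mu}) : Prop :=
  forall t s : ssyt mu, t \in A -> decrement t s -> s \in A.

(* Main.v *)
Require Import Defs.
From mathcomp Require Import all_boot all_order.

(** Let [t] be an entry of [T] and let [s] be obtained from [t] by changing
    an entry [c] to [c - 1]. If [s] were not already an entry of [T], then
    replacing [t] by [s] and sorting would give another strictly increasing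
    column of [n] semistandard tableaux. Its weight is that of [T] with one [c]
    turned into [c - 1], so it dominates the weight of [T] and differs from it:
    this contradicts maximality.

    The total order on tableaux enters only through the fact that strictly
    increasing columns of length [n] are the same as sets of size [n]
    ([plethystic_column], [plethystic_flatten]). Weights are
    compared through their partial sums, which count the entries that are at
    most a given bound ([sumn_take_weight]); lowering an entry can only
    increase these counts ([decrement_count_leq]), and increases the one with
    bound [c - 1] ([decrement_count_ltn]). *)

Set Implicit Arguments.
Unset Strict Implicit.
Unset Printing Implicit Defensive.

Import Order.TTheory.

Lemma ssyt_shape mu (t : ssyt mu) : shape (rows t) = mu.
Proof. by case: t => t /= /andP[/and3P[/eqP]]. Qed.

Lemma size_rows mu (t : ssyt mu) : size (rows t) = size mu.
Proof. by have := congr1 size (ssyt_shape t); rewrite size_map. Qed.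

Lemma size_row mu (t : ssyt mu) i : size (nth [::] (rows t) i) = nth 0 mu i.
Proof.
have /(congr1 (nth 0 ^~ i)) /= <- := ssyt_shape t.
have [lti|lei] := ltnP i (size (rows t)); first by rewrite (nth_map [::]).
by rewrite !nth_default ?size_map.
Qed.

Lemma ssyt_pos mu (t : ssyt mu) : 0 \notin flatten (rows t).
Proof. by case: t => t /= /andP[]. Qed.

Lemma entries_pos mu (T : seq (seq (ssyt mu))) x : x \in entries T -> 0 < x.
Proof.
case/flattenP=> _ /mapP[t _ ->] xt; rewrite lt0n.
by apply: contraNneq (ssyt_pos t) => <-.
Qed.

Lemma sumn_count_mem (T : eqType) (r s : seq T) : uniq r ->
  sumn [seq count_mem b s | b <- r] = count (mem r) s.
Proof.
elim: r => [_|b r IH /andP[br /IH]] /=; first by rewrite count_pred0.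
move=> ->; rewrite -count_predUI [X in _ + X](eq_in_count (a2 := pred0)).
  by rewrite count_pred0 addn0; apply: eq_count => x; rewrite !inE.
by move=> x _ /=; case: eqVneq => // ->; rewrite (negbTE br).
Qed.

(** Every entry is positive and at most the greatest entry of [T], so cutting
    the letters off at either end of the weight loses no entry. *)
Lemma sumn_take_weight mu (T : seq (seq (ssyt mu))) k :
  sumn (take k (weight T)) = count (geq k) (entries T).
Proof.
rewrite /weight -map_take take_iota sumn_count_mem ?iota_uniq //.
apply: eq_in_count => x xT; rewrite /= mem_iota (entries_pos xT) add1n ltnS.
by rewrite leq_min (@leq_bigmax_seq _ _ xpredT id x xT isT) andbT.
Qed.

Lemma count_entries mu (T : seq (seq (ssyt mu))) a :
  count a (entries T) = sumn [seq count a (flatten (rows t)) | t <- flatten T].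
Proof. by rewrite /entries count_flatten -map_comp. Qed.

(** The boxes summed over depend on [mu] only, which lets two tableaux be
    compared box by box. *)
Lemma count_rows mu (t : ssyt mu) a :
  count a (flatten (rows t)) =
    \sum_(i < size mu) \sum_(j < nth 0 mu i) a (entry t i j).
Proof.
rewrite count_flatten sumnE big_map (big_nth [::]) size_rows big_mkord.
apply: eq_bigr => i _; rewrite -sum1_count big_mkcond (big_nth 0) size_row.
by rewrite big_mkord; apply: eq_bigr => j _; rewrite /entry; case: (a _).
Qed.

Lemma decrement_entry_leq mu (t s : ssyt mu) i j :
  decrement t s -> entry s i j <= entry t i j.
Proof.
case=> i0 [j0 [e0 e]]; case: (eqVneq (i, j) (i0, j0)) => [[-> ->]|/e -> //].
by rewrite e0.
Qed.

Lemma entry_geq_mono mu (t s : ssyt mu) k i j :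
  decrement t s -> geq k (entry t i j) <= geq k (entry s i j).
Proof.
move=> /decrement_entry_leq dec /=; case: (leqP (entry t i j) k) => // tk.
by rewrite (leq_trans (dec i j) tk).
Qed.

Lemma decrement_count_leq mu (t s : ssyt mu) k : decrement t s ->
  count (geq k) (flatten (rows t)) <= count (geq k) (flatten (rows s)).
Proof.
move=> dec; rewrite !count_rows; apply: leq_sum => i _; apply: leq_sum => j _.
exact: entry_geq_mono.
Qed.

Lemma ltn_sum_at (I : finType) (F G : I -> nat) i0 :
  (forall i, F i <= G i) -> F i0 < G i0 -> \sum_i F i < \sum_i G i.
Proof.
move=> leFG ltFG; rewrite (bigD1 i0) //= [X in _ < X](bigD1 i0) //=.
by rewrite -addSn leq_add // leq_sum.
Qed.

(** The bound that works is the new value [c - 1] of the lowered entry: its box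
    is counted in [s] but not in [t]. *)
Lemma decrement_count_ltn mu (t s : ssyt mu) : decrement t s ->
  exists k, count (geq k) (flatten (rows t)) < count (geq k) (flatten (rows s)).
Proof.
move=> dec; have [i [j [eij _]]] := dec; exists (entry s i j).
(* [entry] is 0 outside the shape, so a positive value locates the box. *)
have ltj : j < nth 0 mu i.
  rewrite -(size_row t) ltnNge; apply/negP => lej.
  by move: eij; rewrite /entry nth_default.
have lti : i < size mu.
  by rewrite ltnNge; apply/negP => lei; rewrite nth_default in ltj.
rewrite !count_rows; apply: (ltn_sum_at (i0 := Ordinal lti)) => [i'|].
  by apply: leq_sum => j' _; apply: entry_geq_mono.
apply: (ltn_sum_at (i0 := Ordinal ltj)) => [j'|]; first exact: entry_geq_mono.
by rewrite /= eij ltnn leqnn.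
Qed.

Lemma column_singletons (T : Type) (L : seq T) :
  column [seq [:: x] | x <- L] 0 = L.
Proof. by elim: L => //= x L ->. Qed.

Lemma ncolumns_ones n : 0 < n -> ncolumns (nseq n 1) = 1.
Proof.
rewrite /ncolumns; case: n => // n _; elim: n => [|n IH].
  by rewrite big_cons big_nil.
by rewrite [nseq _ _]/= big_cons IH.
Qed.

Lemma plethystic_column mu (L : seq (ssyt mu)) :
  sorted <%O L -> plethystic (nseq (size L) 1) [seq [:: x] | x <- L].
Proof.
move=> sL; apply/and3P; split.
- by apply/eqP; rewrite /shape -map_comp; elim: L {sL} => //= x L ->.
- by rewrite all_map; apply/allP.
- apply/forallP; case: L sL => [|x L] sL j.
    by case: j; rewrite /ncolumns big_nil.
  have : j < 1 by apply: leq_trans (ltn_ord j) _; rewrite ncolumns_ones.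
  by rewrite ltnS leqn0 => /eqP ->; rewrite column_singletons.
Qed.

Lemma flatten_singletons (T : Type) (L : seq T) :
  flatten [seq [:: x] | x <- L] = L.
Proof. by elim: L => //= x L ->. Qed.

Lemma plethystic_flatten mu n (T : seq (seq (ssyt mu))) :
  0 < n -> plethystic (nseq n 1) T ->
  size (flatten T) = n /\ sorted <%O (flatten T).
Proof.
move=> n_gt0 /and3P[/eqP shT _ /forallP cols].
split; first by rewrite size_flatten shT sumn_nseq mul1n.
have ones : T = [seq [:: x] | x <- flatten T].
  elim: T n {n_gt0 cols} shT => [|r T IH] [|n] //= [].
  by case: r => [|x []] //= _ /IH {1}->.
have lt0 : 0 < ncolumns (nseq n 1) by rewrite ncolumns_ones.
by have := cols (Ordinal lt0); rewrite {1}ones column_singletons.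
Qed.

Theorem proposition1p9 (mu : seq nat) (n : nat) (T : seq (seq (ssyt mu)))
    (hmu : is_partition mu) (hn : 0 < n)
    (hT : plethystic (nseq n 1) T)
    (hmax : weight_maximal (nseq n 1) T) :
  closed_ssyt [in flatten T].
Proof.
move=> t s /= tT dec; apply: contraT => sT.
have [szT ltT] := plethystic_flatten hn hT.
have uT := lt_sorted_uniq ltT.
pose L := sort <=%O (s :: rem t (flatten T)).
have LE : perm_eq L (s :: rem t (flatten T)) by rewrite perm_sort.
have ltL : sorted <%O L.
  rewrite lt_sorted_uniq_le sort_le_sorted (perm_uniq LE) /= rem_uniq // !andbT.
  by apply: contra sT; apply: mem_rem.
have szL : size L = n by rewrite (perm_size LE) /= size_rem // szT prednK.
pose T' := [seq [:: x] | x <- L].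
have hT' : plethystic (nseq n 1) T' by rewrite -szL; apply: plethystic_column.
pose c k (u : ssyt mu) := count (geq k) (flatten (rows u)).
pose rest k := sumn [seq c k u | u <- rem t (flatten T)].
have sumT k : sumn (take k (weight T)) = c k t + rest k.
  rewrite sumn_take_weight count_entries.
  exact: (perm_sumn (perm_map (c k) (perm_to_rem tT))).
have sumT' k : sumn (take k (weight T')) = c k s + rest k.
  rewrite sumn_take_weight count_entries flatten_singletons.
  exact: (perm_sumn (perm_map (c k) LE)).
have weq : weight T' = weight T.
  apply: hmax => // k; rewrite sumT sumT' leq_add2r.
  exact: decrement_count_leq.
have [k] := decrement_count_ltn dec; rewrite -/(c k t) -/(c k s).
by rewrite -(ltn_add2r (rest k)) -sumT -sumT' weq ltnn.
Qed.
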